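(* Let $G$ be a topological group and let $f:G\to G$ be a homeomorphism. Then $f$ is topologically equivalent to the inversion of $G$ if and only if there exists a group operation $\oplus$ on the underlying space of $G$ such that $G'=\langle G,\oplus\rangle$ is topologically isomorphic to $G$ and $f$ is the inversion of $G'$.
   Context: For a topological group $G$ and another group operation $\oplus$ on its underlying set, $\langle G,\oplus\rangle$ denotes the underlying topological space of $G$ (with its topology unchanged) equipped with the operation $\oplus$. Two topological groups are topologically isomorphic if there is a group isomorphism between them that is also a homeomorphism. The inversion of a group is the map sending each element to its inverse. Homeomorphisms $f$ and $h$ of a space $X$ are topologically equivalent (topologically conjugate) if there is a homeomorphism $t:X\to X$ with $tf=ht$. *)

(* Defs.v *)
From HB Require Import structures.
From mathcomp Require Import all_boot all_classical topology.

Set Implicit Arguments.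
Unset Strict Implicit.
Unset Printing Implicit Defensive.

Local Open Scope group_scope.
Local Open Scope classical_set_scope.

Definition homeomorphism (X Y : topologicalType) (f : X -> Y) : Prop :=
  continuous f /\
  exists g : Y -> X, [/\ cancel f g, cancel g f & continuous g].

Definition topologically_equivalent (X : topologicalType) (f h : X -> X) : Prop :=
  exists t : X -> X, homeomorphism t /\ t \o f = h \o t.

Definition inversion (G : groupType) (x : G) : G := x^-1.

#[short(type="preTopologicalGroupType")]
HB.structure Definition PreTopologicalGroup := {G of Topological G & Group G}.

(* No separation axiom is part of the definition. *)
Definition group_operations_continuous (G : preTopologicalGroupType) : Prop :=
  continuous (fun xy : G * G => xy.1 * xy.2) /\ continuous (@inversion G).

HB.mixin Record PreTopologicalGroup_isTopologicalGroup G
    of PreTopologicalGroup G := {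
  group_operations_continuousP : group_operations_continuous G
}.

#[short(type="topologicalGroupType")]
HB.structure Definition TopologicalGroup :=
  {G of PreTopologicalGroup G & PreTopologicalGroup_isTopologicalGroup G}.

Definition topologically_isomorphic (G H : preTopologicalGroupType) : Prop :=
  exists phi : G -> H,
    {morph phi : x y / x * y >-> x * y} /\ homeomorphism phi.

(* The neutral element and the inversion are fields, but the laws make them
   functions of the binary operation. *)
Record group_operation (T : Type) := GroupOperation {
  gop_mul :> T -> T -> T;
  gop_one : T;
  gop_inv : T -> T;
  gop_mulA : associative gop_mul;
  gop_mul1g : left_id gop_one gop_mul;
  gop_mulg1 : right_id gop_one gop_mul;
  gop_mulVg : left_inverse gop_one gop_inv gop_mul;
  gop_mulgV : right_inverse gop_one gop_inv gop_mul
}.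

(* <X, oplus>: the space X with its own topology and the group structure of
   oplus; a structure that X may already carry as a group is not inherited. *)
Definition with_operation (X : topologicalType) (oplus : group_operation X)
  : Type := X.

HB.instance Definition _ (X : topologicalType) (oplus : group_operation X) :=
  Topological.copy (with_operation oplus) X.

HB.instance Definition _ (X : topologicalType) (oplus : group_operation X) :=
  isGroup.Build (with_operation oplus) (gop_mulA oplus) (gop_mul1g oplus)
    (gop_mulg1 oplus) (gop_mulVg oplus) (gop_mulgV oplus).

(* Main.v *)
Require Import Defs.
From mathcomp Require Import all_boot all_classical topology.

(** Both conditions say that some homeomorphism [t] of the space satisfies
    [t (f x) = (t x)^-1].  Given such a [t], the group structure of [G] is
    pulled back along it: [x (+) y = t^-1 (t x * t y)].  This makes [t] an
    isomorphism onto [G], and its inversion [t^-1 ((t x)^-1)] is [f].  The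
    operations of the pullback are continuous since [t] and [t^-1] are
    ([transported_operations_continuous]).  Conversely, an isomorphism
    [<G, (+)> -> G] is a homeomorphism of the common underlying space, and like
    every group morphism it intertwines the inversions
    ([topologically_isomorphic_inversion]). *)

Set Implicit Arguments.
Unset Strict Implicit.
Unset Printing Implicit Defensive.

Local Open Scope group_scope.

Section Transport.
Variables (T : Type) (G : groupType) (t : T -> G) (s : G -> T).
Hypotheses (tK : cancel t s) (sK : cancel s t).

Let mul x y := s (t x * t y).
Let one := s 1.
Let inv x := s (t x)^-1.

Fact transported_mulA : associative mul.
Proof. by move=> x y z; rewrite /mul !sK mulgA. Qed.

Fact transported_mul1g : left_id one mul.
Proof. by move=> x; rewrite /mul sK mul1g tK. Qed.

Fact transported_mulg1 : right_id one mul.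
Proof. by move=> x; rewrite /mul sK mulg1 tK. Qed.

Fact transported_mulVg : left_inverse one inv mul.
Proof. by move=> x; rewrite /mul sK mulVg. Qed.

Fact transported_mulgV : right_inverse one inv mul.
Proof. by move=> x; rewrite /mul sK mulgV. Qed.

Definition transported_operation : group_operation T :=
  GroupOperation transported_mulA transported_mul1g transported_mulg1
    transported_mulVg transported_mulgV.

End Transport.

Lemma transported_operations_continuous (X : topologicalType)
    (G : topologicalGroupType) (t : X -> G) (s : G -> X)
    (tK : cancel t s) (sK : cancel s t) :
  continuous t -> continuous s ->
  group_operations_continuous (with_operation (transported_operation tK sK)).
Proof.
move=> tcont scont; have [Mcont Vcont] := @group_operations_continuousP G.
split=> [[x y]|x].
- apply: (@continuous_comp _ _ _ (fun p : X * X => t p.1 * t p.2) s);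
    last exact: scont.
  apply: (@continuous_comp _ _ _ (fun p : X * X => (t p.1, t p.2))
           (fun q : G * G => q.1 * q.2)); last exact: Mcont.
  apply: cvg_pair; apply: continuous_comp; try exact: tcont.
  + exact: cvg_fst.
  + exact: cvg_snd.
- apply: (@continuous_comp _ _ _ (fun z : X => (t z)^-1) s);
    last exact: scont.
  apply: (@continuous_comp _ _ _ t (@inversion G)); first exact: tcont.
  exact: Vcont.
Qed.

Lemma topologically_isomorphic_inversion (G H : preTopologicalGroupType) :
  topologically_isomorphic G H ->
  exists phi : G -> H,
    homeomorphism phi /\ phi \o @inversion G = @inversion H \o phi.
Proof.
move=> [phi [phiM phi_homeo]]; exists phi; split=> //.
have phi1 : phi 1 = 1 by apply: (mulgI (phi 1)); rewrite -phiM !mulg1.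
apply/funext=> x /=; apply: (mulgI (phi x)).
by rewrite /inversion -phiM !mulgV.
Qed.

Theorem theorem2p4 (G : topologicalGroupType) (f : G -> G)
    (hf : homeomorphism f) :
  topologically_equivalent f (@inversion G) <->
  exists oplus : group_operation G,
    [/\ group_operations_continuous (with_operation oplus),
        topologically_isomorphic (with_operation oplus) G
      & f = @inversion (with_operation oplus)].
Proof.
split=> [[t [[tcont [s [tK sK scont]]] tf]]|[oplus [_ iso ->]]].
- exists (transported_operation tK sK); split.
  + exact: transported_operations_continuous.
  + exists t; split; first by move=> x y; exact: sK.
    by split=> //; exists s.
  + apply/funext=> x; rewrite -[LHS]tK.
    exact: (congr1 (fun h : G -> G => s (h x)) tf).
- exact: topologically_isomorphic_inversion iso.
Qed.
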